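(* Let $L$ be a non-empty finite connected flag simplicial complex, let $M\to L$ be a connected regular covering with group of deck transformations $\pi(M,L)$, and let $S\subseteq\mathbb{Z}$. (1) If $G_L^M(S)$ is virtually torsion-free then at least one of the following holds: - $S=\mathbb{Z}$; - $\pi(M,L)$ is torsion-free; - $\pi(M,L)$ is virtually torsion-free and $S$ is periodic. (2) If $G_L^M(S)$ is residually finite then at least one of the following holds: - $S=\mathbb{Z}$; - $\pi(M,L)=\{1\}$; - $\pi(M,L)$ is residually finite and $S$ is closed in the profinite topology on $\mathbb{Z}$.
   Context: A subset $S\subseteq\mathbb{Z}$ is periodic if there is $n>0$ with $S+n=S$. The profinite topology on $\mathbb{Z}$ is the topology having the periodic subsets as a basis of open sets. A flag complex is a simplicial complex in which every finite set of pairwise adjacent vertices spans a simplex. The covering $M\to L$ may be infinite; $M$ is triangulated so that the covering map is simplicial (so $M$ is a flag complex). For a flag complex $K$ with vertex set $K^0$, the right-angled Artin group is $A_K=\langle v\in K^0 : [v,w]=1 \text{ for every edge } \{v,w\} \text{ of } K\rangle$. The height homomorphism $\mathrm{ht}:A_K\to\mathbb{Z}$ sends every vertex to $1$, and the Bestvina-Brady group $BB_K$ is its kernel. The group $\pi=\pi(M,L)$ of deck transformations acts on $A_M$ and on $BB_M$ by permuting the vertices of $M$; form the semidirect products $BB_M\rtimes\pi\le A_M\rtimes\pi$. For $S\subseteq\mathbb{Z}$ let $N(S)$ be the subgroup generated by all $b\pi b^{-1}$ with $b\in A_M$ and $\mathrm{ht}(b)\in S$; it is a normal subgroup of $BB_M\rtimes\pi$.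 Define $G_L^M(S)=(BB_M\rtimes\pi)/N(S)$. *)

(* Defs.v *)
From HB Require Import structures.
From mathcomp Require Import all_boot all_order all_fingroup all_algebra.
From mathcomp Require Import finmap all_classical topology.
From Stdlib Require Import Relation_Operators.

Set Implicit Arguments.
Unset Strict Implicit.
Unset Printing Implicit Defensive.

Import Order.TTheory GRing.Theory Num.Theory.

Local Open Scope classical_set_scope.
Local Open Scope quotient_scope.
Local Open Scope group_scope.

Definition is_subgroup (G : groupType) (H : set G) : Prop :=
  [/\ H 1, forall x y, H x -> H y -> H (x * y) & forall x, H x -> H x^-1].

Definition generated_subgroup (G : groupType) (X : set G) : set G :=
  smallest (@is_subgroup G) X.

Definition finite_index (G : groupType) (H : set G) : Prop :=
  finite_set [set [set x * h | h in H] | x in [set: G]].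

Definition torsion_free_set (G : groupType) (H : set G) : Prop :=
  forall x n, H x -> (0 < n)%N -> x ^+ n = 1 -> x = 1.

Definition torsion_free (G : groupType) : Prop :=
  torsion_free_set [set: G].

Definition virtually_torsion_free (G : groupType) : Prop :=
  exists H : set G, [/\ is_subgroup H, finite_index H & torsion_free_set H].

Definition residually_finite (G : groupType) : Prop :=
  forall x : G, x <> 1 ->
  exists (F : finGroupType) (f : {multiplicative G -> F}), f x <> 1.

Lemma generated_subgroupP (G : groupType) (X : set G) :
  is_subgroup (generated_subgroup X).
Proof.
split.
- by move=> H [[]].
- by move=> x y Hx Hy H [HH XH]; have [_ + _] := HH; apply;
    [apply: Hx | apply: Hy].
- by move=> x Hx H [HH XH]; have [_ _] := HH; apply; apply: Hx.
Qed.

Lemma sub_generated_subgroup (G : groupType) (X : set G) :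
  X `<=` generated_subgroup X.
Proof. by move=> x Xx H [_]; apply. Qed.

Lemma generated_subgroup_min (G : groupType) (X H : set G) :
  is_subgroup H -> X `<=` H -> generated_subgroup X `<=` H.
Proof. by move=> HH XH x; apply. Qed.

Record normal_subgroup (G : groupType) := NormalSubgroup {
  nsub_set : set G;
  nsub_subgroup : is_subgroup nsub_set;
  nsub_normal : forall x y, nsub_set x -> nsub_set (x ^ y)
}.

Section QuotientGroup.
Variables (G : groupType) (N : normal_subgroup G).
Implicit Types x y z : G.

Definition coset_rel x y : bool := `[< nsub_set N (x^-1 * y) >].

Let N1 : nsub_set N 1. Proof. by case: (nsub_subgroup N). Qed.
Let NM x y : nsub_set N x -> nsub_set N y -> nsub_set N (x * y).
Proof. by case: (nsub_subgroup N) => _ + _; apply. Qed.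
Let NV x : nsub_set N x -> nsub_set N x^-1.
Proof. by case: (nsub_subgroup N) => _ _; apply. Qed.

Lemma coset_rel_refl : reflexive coset_rel.
Proof. by move=> x; apply/asboolP; rewrite mulVg. Qed.

Lemma coset_rel_sym : symmetric coset_rel.
Proof.
by move=> x y; apply/idP/idP => /asboolP/NV; rewrite invgM invgK => /asboolP.
Qed.

Lemma coset_rel_trans : transitive coset_rel.
Proof.
move=> y x z /asboolP xy /asboolP yz; apply/asboolP.
by have := NM xy yz; rewrite mulgA mulgK.
Qed.

Canonical coset_equiv :=
  EquivRel coset_rel coset_rel_refl coset_rel_sym coset_rel_trans.

Definition quotient_group : Type := {eq_quot coset_equiv}.
HB.instance Definition _ := Choice.on quotient_group.

Definition to_quotient (x : G) : quotient_group :=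
  \pi_({eq_quot coset_equiv}) x.

Lemma to_quotientP x y :
  to_quotient x = to_quotient y <-> nsub_set N (x^-1 * y).
Proof.
split; first by move/eqmodP/asboolP.
by move=> h; apply/eqmodP/asboolP.
Qed.

Let lift (x : quotient_group) : G :=
  generic_quotient.repr (x : {eq_quot coset_equiv}).
Let liftK (x : quotient_group) : to_quotient (lift x) = x.
Proof. exact: reprK. Qed.

Definition quotient_one := to_quotient 1.
Definition quotient_mul (x y : quotient_group) := to_quotient (lift x * lift y).
Definition quotient_inv (x : quotient_group) := to_quotient (lift x)^-1.

Lemma to_quotientM x y :
  to_quotient (x * y) = quotient_mul (to_quotient x) (to_quotient y).
Proof.
apply/esym/to_quotientP.
have /to_quotientP xh := liftK (to_quotient x).
have /to_quotientP yh := liftK (to_quotient y).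
have := NM (nsub_normal (lift (to_quotient y)) xh) yh.
by rewrite /conjg invgM !mulgA mulgK.
Qed.

Lemma to_quotientV x :
  to_quotient x^-1 = quotient_inv (to_quotient x).
Proof.
apply/esym/to_quotientP.
have /to_quotientP xh := liftK (to_quotient x).
have := nsub_normal (lift (to_quotient x))^-1 (NV xh).
by rewrite /conjg invgM !invgK !mulgA mulgK.
Qed.

Lemma quotient_mulA : associative quotient_mul.
Proof.
move=> x y z; rewrite -(liftK x) -(liftK y) -(liftK z).
by rewrite -!to_quotientM mulgA.
Qed.
Lemma quotient_mul1 : left_id quotient_one quotient_mul.
Proof. by move=> x; rewrite -(liftK x) -to_quotientM mul1g. Qed.
Lemma quotient_1mul : right_id quotient_one quotient_mul.
Proof. by move=> x; rewrite -(liftK x) -to_quotientM mulg1. Qed.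
Lemma quotient_mulV : left_inverse quotient_one quotient_inv quotient_mul.
Proof.
by move=> x; rewrite -(liftK x) -to_quotientV -to_quotientM mulVg.
Qed.
Lemma quotient_Vmul : right_inverse quotient_one quotient_inv quotient_mul.
Proof.
by move=> x; rewrite -(liftK x) -to_quotientV -to_quotientM mulgV.
Qed.

HB.instance Definition _ := isGroup.Build quotient_group
  quotient_mulA quotient_mul1 quotient_1mul quotient_mulV quotient_Vmul.

End QuotientGroup.

Record group_action (P A : groupType) := GroupAction {
  gact :> P -> A -> A;
  gact1 : forall a, gact 1 a = a;
  gactM : forall g h a, gact (g * h) a = gact g (gact h a);
  gact_mul : forall g a b, gact g (a * b) = gact g a * gact g b
}.

Definition sdprod (P A : groupType) (act : group_action P A) : Type :=
  (A * P)%type.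

Section SemidirectProduct.
Variables (P A : groupType) (act : group_action P A).

Lemma gact_one g : act g 1 = 1.
Proof.
by apply: (@mulgI _ (act g 1)); rewrite -gact_mul !mulg1.
Qed.

Lemma gact_inv g a : act g a^-1 = (act g a)^-1.
Proof.
by apply: (@mulgI _ (act g a)); rewrite -gact_mul !mulgV gact_one.
Qed.

HB.instance Definition _ := Choice.copy (sdprod act) (A * P)%type.

Definition sdprod_one : sdprod act := (1, 1).
Definition sdprod_mul (x y : sdprod act) : sdprod act :=
  (x.1 * act x.2 y.1, x.2 * y.2).
Definition sdprod_inv (x : sdprod act) : sdprod act :=
  (act x.2^-1 x.1^-1, x.2^-1).

Lemma sdprod_mulA : associative sdprod_mul.
Proof.
move=> [a g] [b h] [c k]; rewrite /sdprod_mul /=.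
by rewrite gact_mul gactM !mulgA.
Qed.
Lemma sdprod_mul1 : left_id sdprod_one sdprod_mul.
Proof. by move=> [a g]; rewrite /sdprod_mul /= gact1 !mul1g. Qed.
Lemma sdprod_1mul : right_id sdprod_one sdprod_mul.
Proof. by move=> [a g]; rewrite /sdprod_mul /= gact_one !mulg1. Qed.
Lemma sdprod_mulV : left_inverse sdprod_one sdprod_inv sdprod_mul.
Proof.
move=> [a g]; rewrite /sdprod_mul /sdprod_inv /=.
by rewrite -gact_mul !mulVg gact_one.
Qed.
Lemma sdprod_Vmul : right_inverse sdprod_one sdprod_inv sdprod_mul.
Proof.
move=> [a g]; rewrite /sdprod_mul /sdprod_inv /=.
by rewrite -gactM !mulgV gact1 mulgV.
Qed.

HB.instance Definition _ := isGroup.Build (sdprod act)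
  sdprod_mulA sdprod_mul1 sdprod_1mul sdprod_mulV sdprod_Vmul.

Definition sdprod_inl (a : A) : sdprod act := (a, 1).
Definition sdprod_inr (g : P) : sdprod act := (1, g).

Lemma sdprod_mulE (x y : sdprod act) :
  x * y = (x.1 * act x.2 y.1, x.2 * y.2) :> sdprod act.
Proof. by []. Qed.

Lemma sdprod_invE (x : sdprod act) :
  x^-1 = (act x.2^-1 x.1^-1, x.2^-1) :> sdprod act.
Proof. by []. Qed.

Lemma sdprod_inrM g h : sdprod_inr (g * h) = sdprod_inr g * sdprod_inr h.
Proof. by rewrite sdprod_mulE /= gact_one mulg1. Qed.

Lemma sdprod_inrV g : sdprod_inr g^-1 = (sdprod_inr g)^-1.
Proof. by rewrite sdprod_invE /= invg1 gact_one. Qed.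

Lemma sdprod_inl_act (c b : A) (h : P) :
  ((c, h) : sdprod act) * sdprod_inl b * (sdprod_inr h)^-1
  = sdprod_inl (c * act h b).
Proof. by rewrite -sdprod_inrV !sdprod_mulE /= gact_one !mulg1 mulgV. Qed.

End SemidirectProduct.

(* In a word, the letter [(v, true)] stands for the generator [v] and
   [(v, false)] for its inverse; a relation [(u, w)] reads [u = w]. *)
Definition word (V : Type) : Type := seq (V * bool).

Definition inv_word (V : Type) (w : word V) : word V :=
  rev [seq (x.1, ~~ x.2) | x <- w].

Inductive word_eq (V : Type) (R : set (word V * word V)) :
    word V -> word V -> Prop :=
| word_eq_refl u : word_eq R u u
| word_eq_sym u w : word_eq R u w -> word_eq R w u
| word_eq_trans u w t : word_eq R u w -> word_eq R w t -> word_eq R u t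
| word_eq_cat u u' w w' :
    word_eq R u u' -> word_eq R w w' -> word_eq R (u ++ w) (u' ++ w')
| word_eq_cancel v b : word_eq R [:: (v, b); (v, ~~ b)] [::]
| word_eq_rel u w : R (u, w) -> word_eq R u w.

Section Presentation.
Variables (V : choiceType) (R : set (word V * word V)).

Definition word_rel (u w : seq (V * bool)) : bool := `[< word_eq R u w >].

Lemma word_rel_refl : reflexive word_rel.
Proof. by move=> u; apply/asboolP; apply: word_eq_refl. Qed.
Lemma word_rel_sym : symmetric word_rel.
Proof.
by move=> u w; apply/idP/idP => /asboolP h; apply/asboolP; apply: word_eq_sym.
Qed.
Lemma word_rel_trans : transitive word_rel.
Proof.
move=> w u t /asboolP h1 /asboolP h2; apply/asboolP.
exact: word_eq_trans h1 h2.
Qed.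

Canonical word_equiv :=
  EquivRel word_rel word_rel_refl word_rel_sym word_rel_trans.

Definition presented : Type := {eq_quot word_equiv}.
HB.instance Definition _ := Choice.on presented.

Definition of_word (w : word V) : presented :=
  \pi_({eq_quot word_equiv}) w.
Definition to_word (a : presented) : word V :=
  generic_quotient.repr (a : {eq_quot word_equiv}).
Definition presented_gen (v : V) : presented := of_word [:: (v, true)].

Lemma of_wordP u w : of_word u = of_word w <-> word_eq R u w.
Proof.
split; first by move/eqmodP/asboolP.
by move=> h; apply/eqmodP/asboolP.
Qed.

Lemma to_wordK : cancel to_word of_word. Proof. exact: reprK. Qed.

Lemma of_wordK w : word_eq R (to_word (of_word w)) w.
Proof. by apply/of_wordP; rewrite to_wordK. Qed.

Definition presented_one := of_word [::].
Definition presented_mul a b := of_word (to_word a ++ to_word b).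
Definition presented_inv a := of_word (inv_word (to_word a)).

Lemma inv_wordK : involutive (@inv_word V).
Proof.
move=> w; rewrite /inv_word -map_rev revK -map_comp.
by rewrite -[RHS]map_id; apply: eq_map => -[v b] /=; rewrite negbK.
Qed.

Lemma word_eq_inv (w : word V) : word_eq R (w ++ inv_word w) [::].
Proof.
elim: w => [|[v b] w IH]; first exact: word_eq_refl.
have -> : ((v, b) :: w) ++ inv_word ((v, b) :: w)
          = [:: (v, b)] ++ (w ++ inv_word w) ++ [:: (v, ~~ b)].
  by rewrite /inv_word /= rev_cons -cats1 !catA.
apply: word_eq_trans (word_eq_cancel R v b).
apply: (@word_eq_cat _ R _ [:: (v, b)]); first exact: word_eq_refl.
by apply: (@word_eq_cat _ R _ [::]) => //; exact: word_eq_refl.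
Qed.

Lemma of_word_cat u w :
  of_word (u ++ w) = presented_mul (of_word u) (of_word w).
Proof.
by apply/of_wordP/word_eq_cat; apply: word_eq_sym; apply: of_wordK.
Qed.

Lemma presented_mulA : associative presented_mul.
Proof.
move=> a b c; rewrite -(to_wordK a) -(to_wordK b) -(to_wordK c).
by rewrite -!of_word_cat catA.
Qed.
Lemma presented_mul1 : left_id presented_one presented_mul.
Proof. by move=> a; rewrite -(to_wordK a) -of_word_cat. Qed.
Lemma presented_1mul : right_id presented_one presented_mul.
Proof. by move=> a; rewrite -(to_wordK a) -of_word_cat cats0. Qed.
Lemma presented_Vmul : right_inverse presented_one presented_inv presented_mul.
Proof.
move=> a; rewrite -{1}(to_wordK a) -of_word_cat.
by apply/of_wordP; apply: word_eq_inv.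
Qed.
Lemma presented_mulV : left_inverse presented_one presented_inv presented_mul.
Proof.
move=> a; rewrite -{2}(to_wordK a) -of_word_cat.
by apply/of_wordP; rewrite -{2}[to_word a]inv_wordK; apply: word_eq_inv.
Qed.

HB.instance Definition _ := isGroup.Build presented
  presented_mulA presented_mul1 presented_1mul presented_mulV presented_Vmul.

Lemma of_wordM u w : of_word (u ++ w) = of_word u * of_word w.
Proof. exact: of_word_cat. Qed.

End Presentation.

Record scomplex := SComplex {
  vertex :> choiceType;
  simplex : set {fset vertex};
  simplex1 : forall v, simplex [fset v]%fset;
  simplex_neq0 : forall s, simplex s -> s != fset0;
  simplexS : forall s t,
    s != fset0 -> (s `<=` t)%fset -> simplex t -> simplex s
}.

Definition sc_nonempty (K : scomplex) : Prop := [set: K] !=set0.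

Definition sc_finite (K : scomplex) : Prop := finite_set [set: K].

Definition adjacent (K : scomplex) (u v : K) : Prop :=
  u != v /\ simplex [fset u; v]%fset.

Definition sc_flag (K : scomplex) : Prop :=
  forall s : {fset K}, s != fset0 ->
  {in s &, forall u v, u != v -> adjacent u v} -> simplex s.

(* Connectedness of the 1-skeleton, which is that of the complex. *)
Definition sc_connected (K : scomplex) : Prop :=
  forall u v : K, clos_refl_trans K (@adjacent K) u v.

Definition closed_star (K : scomplex) (v : K) : set {fset K} :=
  [set s | simplex s /\ simplex (v |` s)%fset].

Definition simplicial (M L : scomplex) (p : M -> L) : Prop :=
  forall s : {fset M}, simplex s -> simplex (p @` s)%fset.

(* A simplicial map is a covering when it is onto and is an isomorphism from
   the closed star of each vertex [v] to that of [p v].  Since vertices are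
   simplices, bijectivity on simplices gives bijectivity on vertices. *)
Definition sc_covering (M L : scomplex) (p : M -> L) : Prop :=
  [/\ simplicial p,
      set_surj [set: M] [set: L] p &
      forall v : M, set_bij (closed_star v) (closed_star (p v))
                            (fun s : {fset M} => (p @` s)%fset)].

Definition is_deck (M L : scomplex) (p : M -> L) (g : M -> M) : Prop :=
  [/\ bijective g,
      forall s : {fset M}, simplex (g @` s)%fset <-> simplex s &
      forall v, p (g v) = p v].

Section DeckGroup.
Variables (M L : scomplex) (p : M -> L).

Definition deck : Type := {g : M -> M | `[< is_deck p g >]}.
HB.instance Definition _ := Choice.on deck.

Definition deck_fun (g : deck) : M -> M := sval g.

Lemma deckP (g : deck) : is_deck p (deck_fun g).
Proof. by case: g => g /= /asboolP. Qed.

Lemma deck_ext (g h : deck) : deck_fun g =1 deck_fun h -> g = h.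
Proof. by move=> gh; apply: val_inj; apply/funext. Qed.

Definition Deck (g : M -> M) (gP : is_deck p g) : deck :=
  exist (fun h => `[< is_deck p h >]) g (asboolT gP).

Lemma is_deck_id : is_deck p id.
Proof.
by split=> [|s|//]; [exists id | rewrite imfset_id].
Qed.

Lemma is_deck_comp g h : is_deck p g -> is_deck p h -> is_deck p (g \o h).
Proof.
move=> [gB gS gp] [hB hS hp]; split=> [|s|v]; first exact: bij_comp.
- by rewrite imfset_comp gS hS.
- by rewrite /= gp hp.
Qed.

Lemma is_deck_can g h : is_deck p g -> cancel h g -> is_deck p h.
Proof.
move=> [gB gS gp] hK; split=> [|s|v].
- have gK : cancel g h by apply/(bij_can_sym gB).
  by exists g.
- rewrite -gS -imfset_comp.
  suff -> : ((g \o h) @` s)%fset = s by [].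
  by rewrite -[RHS]imfset_id; apply: eq_imfset => // x; exact: hK.
- by rewrite -{2}(hK v) gp.
Qed.

Lemma deck_onto (g : deck) (v : M) : exists u, deck_fun g u == v.
Proof.
by have [[h _ hK] _ _] := deckP g; exists (h v); rewrite hK.
Qed.

Lemma deck_xchooseK (g : deck) :
  cancel (fun v => xchoose (deck_onto g v)) (deck_fun g).
Proof. by move=> v; exact/eqP/(xchooseP (deck_onto g v)). Qed.

Definition deck_one : deck := Deck is_deck_id.
Definition deck_mul (g h : deck) : deck :=
  Deck (is_deck_comp (deckP g) (deckP h)).
Definition deck_inv (g : deck) : deck :=
  Deck (is_deck_can (deckP g) (@deck_xchooseK g)).

Lemma deck_mulA : associative deck_mul.
Proof. by move=> f g h; apply: deck_ext. Qed.
Lemma deck_mul1 : left_id deck_one deck_mul.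
Proof. by move=> g; apply: deck_ext. Qed.
Lemma deck_1mul : right_id deck_one deck_mul.
Proof. by move=> g; apply: deck_ext. Qed.
Lemma deck_Vmul : right_inverse deck_one deck_inv deck_mul.
Proof. by move=> g; apply: deck_ext => v; exact: deck_xchooseK. Qed.
Lemma deck_mulV : left_inverse deck_one deck_inv deck_mul.
Proof.
move=> g; apply: deck_ext => v; have [gB _ _] := deckP g.
by apply: (bij_inj gB); rewrite /= deck_xchooseK.
Qed.

HB.instance Definition _ := isGroup.Build deck
  deck_mulA deck_mul1 deck_1mul deck_mulV deck_Vmul.

Lemma deck_fun1 v : deck_fun 1 v = v. Proof. by []. Qed.
Lemma deck_funM g h v : deck_fun (g * h) v = deck_fun g (deck_fun h v).
Proof. by []. Qed.

Lemma deck_adjacent (g : deck) (u v : M) :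
  adjacent u v -> adjacent (deck_fun g u) (deck_fun g v).
Proof.
move=> [uv suv]; have [gB gS _] := deckP g; split.
  by rewrite (inj_eq (bij_inj gB)).
have -> : [fset deck_fun g u; deck_fun g v]%fset
          = (deck_fun g @` [fset u; v])%fset by rewrite imfset_fset2.
exact/gS.
Qed.

End DeckGroup.

Definition sc_regular (M L : scomplex) (p : M -> L) : Prop :=
  forall u v : M, p u = p v -> exists g : deck p, deck_fun g u = v.

Definition raag_rel (K : scomplex) : set (word K * word K) :=
  [set r | exists v w : K, adjacent v w /\
     r = ([:: (v, true); (w, true)], [:: (w, true); (v, true)])].

Notation raag K := (presented (@raag_rel K)).

Section Height.
Variable K : scomplex.

Definition word_height (w : word K) : int :=
  (\sum_(x <- w) (if x.2 then 1 else -1))%R.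

Definition height (a : raag K) : int := word_height (to_word a).

Lemma word_height_eq u w :
  word_eq (@raag_rel K) u w -> word_height u = word_height w.
Proof.
elim=> {u w} //.
- by move=> u w t _ -> _ ->.
- by move=> u u' w w' _ eu _ ew; rewrite /word_height !big_cat /= -!/(word_height _);
    rewrite eu ew.
- by move=> v b; rewrite /word_height !big_cons big_nil; case: b.
- by move=> u w [v [v' [_ [-> ->]]]]; rewrite /word_height !big_cons !big_nil.
Qed.

Lemma height_of_word w : height (of_word _ w) = word_height w.
Proof. exact/word_height_eq/of_wordK. Qed.

Lemma height_gen v : height (presented_gen _ v) = 1%R.
Proof. by rewrite height_of_word /word_height big_seq1. Qed.

Lemma heightM a b : height (a * b) = (height a + height b)%R.
Proof. by rewrite height_of_word /word_height big_cat. Qed.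

Lemma height1 : height 1 = 0%R.
Proof. by rewrite height_of_word /word_height big_nil. Qed.

Lemma heightV a : height a^-1 = (- height a)%R.
Proof. by apply: (addrI (height a)); rewrite -heightM mulgV height1 subrr. Qed.

End Height.

Section DeckAction.
Variables (M L : scomplex) (p : M -> L).

Definition word_act (g : deck p) (w : word M) : word M :=
  [seq (deck_fun g x.1, x.2) | x <- w].

Lemma word_act_eq g u w :
  word_eq (@raag_rel M) u w ->
  word_eq (@raag_rel M) (word_act g u) (word_act g w).
Proof.
elim=> {u w}.
- by move=> u; apply: word_eq_refl.
- by move=> u w _; apply: word_eq_sym.
- by move=> u w t _ h1 _ h2; apply: word_eq_trans h1 h2.
- by move=> u u' w w' _ h1 _ h2; rewrite /word_act !map_cat; apply: word_eq_cat.
- by move=> v b; apply: word_eq_cancel.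
- move=> u w [v [v' [vv' [-> ->]]]]; apply: word_eq_rel.
  by exists (deck_fun g v), (deck_fun g v'); split=> //; exact: deck_adjacent.
Qed.

Definition raag_act_fun (g : deck p) (a : raag M) : raag M :=
  of_word _ (word_act g (to_word a)).

Lemma raag_act_of_word g w :
  raag_act_fun g (of_word _ w) = of_word _ (word_act g w).
Proof. exact/of_wordP/word_act_eq/of_wordK. Qed.

Lemma raag_act1 a : raag_act_fun 1 a = a.
Proof.
rewrite -[RHS]to_wordK /raag_act_fun; congr of_word.
by rewrite -[RHS]map_id; apply: eq_map => -[].
Qed.

Lemma raag_actM g h a :
  raag_act_fun (g * h) a = raag_act_fun g (raag_act_fun h a).
Proof.
rewrite -(to_wordK a) !raag_act_of_word; congr of_word.
by rewrite /word_act -map_comp.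
Qed.

Lemma raag_act_mul g a b :
  raag_act_fun g (a * b) = raag_act_fun g a * raag_act_fun g b.
Proof.
rewrite -(to_wordK a) -(to_wordK b) -of_wordM !raag_act_of_word -of_wordM.
by rewrite /word_act map_cat.
Qed.

Definition raag_act : group_action (deck p) (raag M) :=
  GroupAction raag_act1 raag_actM raag_act_mul.

Lemma height_act g a : height (raag_act g a) = height a.
Proof. by rewrite [LHS]height_of_word /word_height big_map. Qed.

Notation raag_deck := (sdprod raag_act).

(* [BB_deck] is the semidirect product of BB_M (the kernel of [height]) and the
   deck group, as a subgroup of that of A_M and the deck group. *)
Definition in_BB_deck : {pred raag_deck} :=
  [pred x : raag_deck | height x.1 == 0%R].

Lemma in_BB_deck_closed : group_closed in_BB_deck.
Proof.
split; first by rewrite inE height1.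
move=> [a g] [b h]; rewrite !inE /= => /eqP a0 /eqP b0.
by rewrite heightM !(height_act, heightV) a0 b0 subrr.
Qed.

Definition BB_deck : Type := {x : raag_deck | in_BB_deck x}.
HB.instance Definition _ := SubChoice.on BB_deck.
HB.instance Definition _ :=
  SubChoice_isSubGroup.Build raag_deck in_BB_deck BB_deck in_BB_deck_closed.

Variable S : set int.

Definition conj_deck_gens : set raag_deck :=
  [set x | exists (b : raag M) (g : deck p), S (height b) /\
     x = sdprod_inl raag_act b * sdprod_inr raag_act g
         * (sdprod_inl raag_act b)^-1].

Definition N_subgroup : set raag_deck := generated_subgroup conj_deck_gens.

Lemma conj_deck_gensJ (x y : raag_deck) :
  in_BB_deck y -> conj_deck_gens x -> conj_deck_gens (x ^ y).
Proof.
move=> yB; rewrite -[y]invgK.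
have : in_BB_deck y^-1 by exact: (group_closedV in_BB_deck_closed).
move: (y^-1) => [c h] /eqP /= c0 [b [g [Sb ->]]].
exists (c * raag_act h b), (h * g * h^-1); split.
  by rewrite heightM height_act c0 add0r.
rewrite -sdprod_inl_act !sdprod_inrM sdprod_inrV /conjg !invgM !invgK !mulgA.
by rewrite !(mulgKV, mulgK).
Qed.

Lemma conjg_generated (x y : raag_deck) :
  in_BB_deck y -> N_subgroup x -> N_subgroup (x ^ y).
Proof.
move=> yB; have [N1 NM NV] := generated_subgroupP conj_deck_gens.
pose H : set raag_deck := [set z | N_subgroup (z ^ y)].
apply: (@generated_subgroup_min _ _ H) => [|z Xz]; last first.
  by apply: sub_generated_subgroup; exact: conj_deck_gensJ.
split; rewrite /H /=; first by rewrite conj1g.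
- by move=> u v Nu Nv; rewrite conjMg; exact: NM.
- by move=> u Nu; rewrite conjVg; exact: NV.
Qed.

Definition N_set : set BB_deck := [set x | N_subgroup (val x)].

Lemma N_set_subgroup : is_subgroup N_set.
Proof.
have [N1 NM NV] := generated_subgroupP conj_deck_gens.
split; first exact: N1.
- by move=> x y Nx Ny; exact: (NM _ _ Nx Ny).
- by move=> x Nx; exact: (NV _ Nx).
Qed.

Lemma N_set_normal (x y : BB_deck) : N_set x -> N_set (x ^ y).
Proof.
move=> Nx; exact: (conjg_generated (valP y) Nx).
Qed.

Definition N_BB : normal_subgroup BB_deck :=
  NormalSubgroup N_set_subgroup N_set_normal.

Lemma N_subgroup_BB : N_subgroup `<=` [set x | in_BB_deck x].
Proof.
apply: generated_subgroup_min; last first.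
  move=> _ [b [g [_ ->]]]; apply/eqP => /=.
  by rewrite !(heightM, height_act, heightV, height1) addr0 subrr.
split=> /=.
- exact: in_BB_deck_closed.1.
- exact: (group_closedM in_BB_deck_closed).
- exact: (group_closedV in_BB_deck_closed).
Qed.

(* The group G_L^M(S), with [p : M -> L] the covering. *)
Definition GLM : Type := quotient_group N_BB.
HB.instance Definition _ := Group.copy GLM (quotient_group N_BB).

End DeckAction.

Definition periodic (S : set int) : Prop :=
  exists2 n : int, (0 < n)%R & [set (s + n)%R | s in S] = S.

(* A copy of [int] that carries the profinite topology: the periodic sets are
   a base of open sets. *)
Definition profinite_int : Type := int.
HB.instance Definition _ := Choice.on profinite_int.

Lemma periodicT : periodic setT.
Proof.
exists 1%R => //; rewrite -subTset => k _.
by exists (k - 1)%R => //; rewrite subrK.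
Qed.

Lemma periodicP (S : set int) (n : int) :
  [set (s + n)%R | s in S] = S <-> forall k, S (k + n)%R <-> S k.
Proof.
split=> [e k|e].
  split=> [|Sk]; last by rewrite -e; exists k.
  by rewrite -{1}e => -[s Ss /addIr <-].
apply/seteqP; split=> [_ [s Ss <-]|k Sk]; first exact/e.
by exists (k - n)%R; rewrite ?subrK//; apply/e; rewrite subrK.
Qed.

Lemma periodic_mul (S : set int) (n : int) (m : nat) :
  (forall k, S (k + n)%R <-> S k) -> forall k, S (k + n *+ m)%R <-> S k.
Proof.
move=> e; elim: m => [|m IH] k; first by rewrite mulr0n addr0.
by rewrite mulrSr addrA e IH.
Qed.

Lemma periodicI (S T : set int) :
  periodic S -> periodic T -> periodic (S `&` T).
Proof.
move=> [n n0 /periodicP Sn] [m m0 /periodicP Tm]; exists (n * m)%R.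
  exact: mulr_gt0.
case: n m n0 m0 Sn Tm => [n|//] [m|//] _ _ Sn Tm.
apply/periodicP => k; rewrite /setI /=.
have := periodic_mul m Sn k; have := periodic_mul n Tm k.
rewrite -[((m : int) *+ n)%R]mulr_natr -[((n : int) *+ m)%R]mulr_natr !natz.
by rewrite [((m : int) * n)%R]mulrC => -> ->.
Qed.

Lemma periodic_cover : \bigcup_(S in periodic) S = [set: profinite_int].
Proof. by rewrite -subTset => k _; exists setT => //; exact: periodicT. Qed.

Lemma periodic_join (S T : set profinite_int) (k : profinite_int) :
  periodic S -> periodic T -> S k -> T k ->
  exists U : set profinite_int, [/\ periodic U, U k & U `<=` S `&` T].
Proof. by move=> pS pT Sk Tk; exists (S `&` T); split=> //; exact: periodicI. Qed.

HB.instance Definition _ := isBaseTopological.Build profinite_int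
  periodic_cover periodic_join.

(* Main.v *)
Require Import Defs.
From HB Require Import structures.
From mathcomp Require Import all_boot all_order all_fingroup all_algebra.
From mathcomp Require Import cyclic finmap all_classical topology.

Set Implicit Arguments.
Unset Strict Implicit.
Unset Printing Implicit Defensive.

Import Order.TTheory GRing.Theory Num.Theory.

Local Open Scope classical_set_scope.
Local Open Scope group_scope.

(** Write [A_M] for the right-angled Artin group of [M] and [pi] for the deck
    group. For [b] in [A_M] the conjugate of [pi] by [b] maps to the quotient
    [G] of the theorem, trivially if the height of [b] is in [S]. Both parts
    follow from two facts.

    If the height of [b] is not in [S], this map is injective
    ([conj_notin_N_subgroup]). It suffices to find an action of the semidirect
    product of [A_M] and [pi] with a point that is moved by every nontrivial
    element of the conjugate of [pi] by [b], but fixed by the conjugates by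
    elements of any other height. The points are pairs of an element of [A_L] and
    of a sheet in [pi]. Sheets are followed along edges of the Cayley graph of
    [A_L] by unique lifting from [L] to [M]: an element [a] other than [1] is
    sent to the simplex of [L] formed by its possible last letters, and
    neighbouring elements have nested simplices, so that a path in the Cayley
    graph avoiding [1] gives a path in [L]. At [1] itself the sheet to enter is
    prescribed by the vertex of [M] by which one leaves, and [pi] acts by permuting
    the sheets over [1] only. This is the combinatorial form of a branched cover
    of the cube complex of [A_L]. The squares of the Cayley graph have trivial
    holonomy ([step_comm]), which makes it an action of [A_M].

    If [K] is a normal subgroup of [G] containing all [N]-th powers, [u] is a
    vertex of [M] and [g] is in [pi], then the set of [n] for which the
    conjugate of [g] by [u^n] is in [K] has period [N] ([vertex_map_periodic]). By
    connectedness, the quotient of [u^n] by the [n]-th power of the translate of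
    [u] by [g] is a product of elements [(v w^-1)^n] with [v] and [w] adjacent, and
    these only depend on [n] modulo [N] in [G/K].

    So if [S] is not all of the integers, [pi] embeds in [G] and inherits
    both finiteness properties. For a torsion-free subgroup of finite index with
    core [K] and [g] nontrivial of finite order, the periodic set is exactly [S].
    For a finite quotient with kernel [K] in which the conjugate of a nontrivial
    [g] by [u^k] survives, with [k] not in [S], the complement of the periodic set
    is a periodic neighbourhood of [k] disjoint from [S]. *)

(** * Reduced words up to commutation *)

Section ReducedWords.
Variables (V : eqType) (adj : rel V).
Hypotheses (adjC : symmetric adj) (adj_irr : irreflexive adj).
Implicit Types (x y : V * bool) (u w : seq (V * bool)).

Definition inv_letter x : V * bool := (x.1, ~~ x.2).
Definition commuting x y := adj x.1 y.1.

(** A letter is movable when commutations can bring it to the front. *)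
Fixpoint movable x w :=
  if w is y :: u then (y == x) || (commuting x y && movable x u) else false.

Fixpoint reduced w :=
  if w is x :: u then ~~ movable (inv_letter x) u && reduced u else true.

(** Left multiplication by a letter on reduced words. *)
Definition push x w :=
  if movable (inv_letter x) w then rem (inv_letter x) w else x :: w.

Inductive shuffle : seq (V * bool) -> seq (V * bool) -> Prop :=
| shuffle_refl w : shuffle w w
| shuffle_trans w u t : shuffle w u -> shuffle u t -> shuffle w t
| shuffle_swap x y w :
    commuting x y -> shuffle (x :: y :: w) (y :: x :: w)
| shuffle_cons x u w : shuffle u w -> shuffle (x :: u) (x :: w).

Lemma inv_letterK : involutive inv_letter.
Proof. by move=> [v b]; rewrite /inv_letter /= negbK. Qed.

Lemma commutingC x y : commuting x y = commuting y x.
Proof. exact: adjC. Qed.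

Lemma commuting_neq x y : commuting x y -> (x == y) = false.
Proof. by move=> cxy; apply/eqP => exy; rewrite exy /commuting adj_irr in cxy. Qed.

Lemma shuffle_sym u w : shuffle u w -> shuffle w u.
Proof.
elim=> {u w}.
- exact: shuffle_refl.
- by move=> w u t _ wu _ ut; apply: shuffle_trans ut wu.
- by move=> x y w cxy; apply: shuffle_swap; rewrite commutingC.
- by move=> x u w _; apply: shuffle_cons.
Qed.

Lemma movable_shuffle x u w : shuffle u w -> movable x u = movable x w.
Proof.
elim=> {u w} //=.
- by move=> w u t _ -> _ ->.
- move=> a b w cab.
  case: (a =P x) => [<-|_] /=; first by rewrite cab orbT.
  case: (b =P x) => [<-|_] /=; first by rewrite commutingC cab.
  by rewrite andbCA.
- by move=> a u w _ ->.
Qed.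

Lemma shuffle_rem x u w :
  shuffle u w -> movable x u -> shuffle (rem x u) (rem x w).
Proof.
elim=> {u w} /=.
- by move=> *; apply: shuffle_refl.
- move=> w u t wu IHw _ IHu xw; apply: shuffle_trans (IHw xw) (IHu _).
  by rewrite -(movable_shuffle x wu).
- move=> a b w cab; have ab := commuting_neq cab.
  case: (a =P x) => [<- _|_] /=; first by rewrite eq_sym ab; apply: shuffle_refl.
  by case: (b =P x) => _ _; [apply: shuffle_refl|apply: shuffle_swap].
- move=> a u w uw IH; case: (a =P x) => //= _ /andP[_ xu].
  exact/shuffle_cons/IH.
Qed.

(** This is what makes [movable] and [rem] mean what they should: up to
    commutation, a movable letter is the first one. *)
Lemma movable_front x w : movable x w -> shuffle w (x :: rem x w).
Proof.
elim: w => //= a w IH; case: (a =P x) => [->|_] /=.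
  by move=> _; apply: shuffle_refl.
move=> /andP[cxa /IH wx]; apply: shuffle_trans (shuffle_cons a wx) _.
by apply: shuffle_swap; rewrite commutingC.
Qed.

Lemma movable_cons_comm x y w :
  commuting x y -> movable x (y :: w) = movable x w.
Proof. by move=> cxy /=; rewrite cxy eq_sym commuting_neq. Qed.

Lemma movable_rem x y w :
  commuting x y -> movable y w -> movable x (rem y w) = movable x w.
Proof.
move=> cxy /movable_front wy.
by rewrite (movable_shuffle x wy) movable_cons_comm.
Qed.

Lemma reduced_shuffle u w : shuffle u w -> reduced u = reduced w.
Proof.
elim=> {u w} //.
- by move=> w u t _ -> _ ->.
- move=> a b w cab; rewrite /reduced -/reduced.
  have cba : commuting b a by rewrite commutingC.
  by rewrite (@movable_cons_comm (inv_letter a)) // movable_cons_comm // andbCA.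
- by move=> a u w uw /= ->; rewrite (movable_shuffle _ uw).
Qed.

Lemma remC x y w : rem x (rem y w) = rem y (rem x w).
Proof.
have [<- //|xy] := eqVneq x y; elim: w => //= a w IH.
have [ax|ax] := eqVneq a x; have [ay|ay] := eqVneq a y => /=.
- by rewrite -ax -ay eqxx in xy.
- by rewrite ax eqxx.
- by rewrite ay eqxx.
- by rewrite (negPf ax) (negPf ay) IH.
Qed.

Lemma push_shuffle x u w : shuffle u w -> shuffle (push x u) (push x w).
Proof.
move=> uw; rewrite /push -(movable_shuffle _ uw).
by case: ifP => [/(shuffle_rem uw)|_] //; apply: shuffle_cons.
Qed.

Lemma push_reduced x w : reduced w -> reduced (push x w).
Proof.
rewrite /push; case: ifP => [/movable_front wx|/= -> //].
by rewrite (reduced_shuffle wx) /= => /andP[].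
Qed.

(** The only place where reducedness matters: if pushing [x] has cancelled a
    first letter, pushing the inverse of [x] must restore that letter instead of
    cancelling a second one. *)
Lemma pushK x w : reduced w -> shuffle (push (inv_letter x) (push x w)) w.
Proof.
move=> rw; rewrite {2}/push; case: ifP => [mx|_].
  have wx := movable_front mx.
  move: rw; rewrite (reduced_shuffle wx) /= => /andP[nx _].
  by rewrite /push (negPf nx); apply: shuffle_sym.
by rewrite /push inv_letterK /= eqxx; apply: shuffle_refl.
Qed.

(** Together with [pushK] this says that the defining relations of the
    right-angled Artin group hold for [push], up to [shuffle]. *)
Lemma pushC x y w :
  commuting x y -> shuffle (push x (push y w)) (push y (push x w)).
Proof.
move=> cxy; have cyx : commuting y x by rewrite commutingC.
have nxy : (y == inv_letter x) = false by apply: commuting_neq.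
have nyx : (x == inv_letter y) = false by apply: commuting_neq.
rewrite /push; case: (boolP (movable (inv_letter x) w)) => mx;
  case: (boolP (movable (inv_letter y) w)) => my.
- by rewrite !movable_rem // mx my remC; apply: shuffle_refl.
- rewrite movable_cons_comm // mx movable_rem // (negPf my) /= nxy.
  exact: shuffle_refl.
- rewrite movable_cons_comm // my movable_rem // (negPf mx) /= nyx.
  exact: shuffle_refl.
- by rewrite !movable_cons_comm // (negPf mx) (negPf my); apply: shuffle_swap.
Qed.

Definition push_word u w := foldr push w u.

Lemma push_word_reduced u w : reduced w -> reduced (push_word u w).
Proof. by move=> rw; elim: u => //= x u; apply: push_reduced. Qed.

Lemma push_word_shuffle t u w :
  shuffle u w -> shuffle (push_word t u) (push_word t w).
Proof. by move=> uw; elim: t => //= x t; apply: push_shuffle. Qed.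

(** The vertices of the letters that commutations can bring to the end of a
    word, that is, of the possible last letters. *)
Fixpoint last_vertex (v : V) w :=
  if w is x :: u
  then last_vertex v u || ((x.1 == v) && all (fun y => adj y.1 v) u)
  else false.

Lemma all_shuffle (P : pred (V * bool)) u w : shuffle u w -> all P u = all P w.
Proof.
elim=> {u w} //=; first by move=> w u t _ -> _ ->.
- by move=> x y w _; rewrite andbCA.
- by move=> x u w _ ->.
Qed.

Lemma last_vertex_shuffle v u w :
  shuffle u w -> last_vertex v u = last_vertex v w.
Proof.
elim=> {u w} //=; first by move=> w u t _ -> _ ->.
- move=> x y w cxy; rewrite -!orbA; congr orb.
  have [xv|] := eqVneq x.1 v; have [yv|] := eqVneq y.1 v => //= *.
  + by move: cxy; rewrite /commuting xv yv adj_irr.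
  + by rewrite orbF -xv adjC -[adj _ _]/(commuting x y) cxy.
  + by rewrite orbF -yv -[adj _ _]/(commuting x y) cxy.
- by move=> x u w uw ->; rewrite (all_shuffle _ uw).
Qed.

Lemma last_vertex_all v (P : pred V) w :
  last_vertex v w -> all (fun y => P y.1) w -> P v.
Proof.
elim: w => //= x w IH /orP[vw|/andP[/eqP<- _]] /andP[Px Pw] //.
exact: IH.
Qed.

(** Two distinct letters that can both come last have to be exchangeable,
    hence commute. *)
Lemma last_vertex_clique v v' w :
  last_vertex v w -> last_vertex v' w -> v = v' \/ adj v v'.
Proof.
elim: w => //= x w IH /orP[vw|/andP[/eqP xv aw]] /orP[v'w|/andP[/eqP xv' aw']].
- exact: IH.
- by right; exact: (@last_vertex_all v (adj^~ v') w vw aw').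
- by right; rewrite adjC; exact: (@last_vertex_all v' (adj^~ v) w v'w aw).
- by left; rewrite -xv.
Qed.

Lemma last_vertex_last x w : last_vertex (last x w).1 (x :: w).
Proof.
elim: w x => [|y w IH] x; first by rewrite /= eqxx.
by apply/orP; left; apply: IH.
Qed.

(** Left multiplication adds or deletes a letter at the left end, so the set of
    possible last letters can only grow in the first case and shrink in the
    second. *)
Lemma push_last_vertex x w :
  (forall v, last_vertex v w -> last_vertex v (push x w)) \/
  (forall v, last_vertex v (push x w) -> last_vertex v w).
Proof.
rewrite /push; case: ifP => [/movable_front wx|_]; [right|left] => v.
  by rewrite (last_vertex_shuffle v wx) /= => ->.
by move=> /= ->.
Qed.

End ReducedWords.
(** * Unique lifting along a covering of flag complexes *)

Definition neighbor (K : scomplex) (u v : K) : Prop := u = v \/ adjacent u v.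

Lemma adjacent_sym (K : scomplex) (u v : K) : adjacent u v -> adjacent v u.
Proof. by move=> [uv suv]; split; [rewrite eq_sym | rewrite fsetUC]. Qed.

Lemma neighbor_sym (K : scomplex) (u v : K) : neighbor u v -> neighbor v u.
Proof. by move=> [->|/adjacent_sym ?]; [left|right]. Qed.

Lemma simplex_neighbor (K : scomplex) (s : {fset K}) (u v : K) :
  simplex s -> u \in s -> v \in s -> neighbor u v.
Proof.
move=> ss us vs; have [->|uv] := eqVneq u v; first by left.
right; split=> //; apply: simplexS ss.
  by apply/fset0Pn; exists u; rewrite !inE eqxx.
by apply/fsubsetP => x; rewrite !inE => /orP[]/eqP->.
Qed.

Lemma fset2_star (K : scomplex) (u v : K) :
  neighbor u v -> closed_star u [fset v]%fset.
Proof.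
move=> uv; split; first exact: simplex1.
by case: uv => [->|[_ //]]; rewrite fsetUid; apply: simplex1.
Qed.

Lemma flag_triangle (K : scomplex) (u v w : K) :
  sc_flag K -> neighbor u v -> neighbor v w -> neighbor u w ->
  simplex [fset u; v; w]%fset.
Proof.
move=> Kflag uv vw uw; apply: Kflag.
  by apply/fset0Pn; exists u; rewrite !inE eqxx.
have adj a b : neighbor a b -> a != b -> adjacent a b.
  by case=> [->|//]; rewrite eqxx.
move=> a b; rewrite !inE -!orbA => /or3P[]/eqP-> /or3P[]/eqP-> /adj; apply=> //;
  first [by left | exact: neighbor_sym].
Qed.

Section Covering.
Variables (L M : scomplex) (p : M -> L).
Hypotheses (Lflag : sc_flag L) (Mconn : sc_connected M).
Hypotheses (pcov : sc_covering p) (preg : sc_regular p).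

Lemma star_inj (v : M) (s t : {fset M}) :
  closed_star v s -> closed_star v t -> (p @` s = p @` t)%fset -> s = t.
Proof.
move=> vs vt; have [_ _ /(_ v)[_ inj _]] := pcov.
by apply: inj; apply: mem_set.
Qed.

(** The covering is injective on the star of [u]. *)
Lemma neighbor_lift_unique (u v v' : M) :
  neighbor u v -> neighbor u v' -> p v = p v' -> v = v'.
Proof.
move=> uv uv' pvv'; apply/fset1P.
rewrite -[[fset v']%fset](_ : [fset v]%fset = _).
  by rewrite inE.
by apply: star_inj (fset2_star uv) (fset2_star uv') _; rewrite !imfset_fset1 pvv'.
Qed.

Lemma covering_neighbor (u v : M) : neighbor u v -> neighbor (p u) (p v).
Proof.
move=> [->|uv]; first by left.
have [psim _ _] := pcov.
by apply: (simplex_neighbor (psim _ uv.2)); apply: in_imfset; rewrite !inE eqxx ?orbT.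
Qed.

Lemma neighbor_lift (u : M) (l : L) :
  neighbor (p u) l -> exists2 v, neighbor u v & p v = l.
Proof.
move=> /fset2_star ul; have [_ _ /(_ u)[_ _ surj]] := pcov.
have [s [_ sus] /= psl] := surj _ ul.
have /imfsetP[v /= vs lv] : l \in (p @` s)%fset by rewrite psl inE.
exists v => //; apply: simplex_neighbor sus _ _; first by rewrite !inE eqxx.
by rewrite !inE vs orbT.
Qed.

(** The triangle on the three images is a simplex since [L] is flag; its lift
    at [v] must contain [u] and [w], by unique lifting of edges. *)
Lemma neighbor_lift_trans (u v w : M) :
  neighbor v u -> neighbor v w -> neighbor (p u) (p w) -> neighbor u w.
Proof.
move=> vu vw puw; have [_ _ /(_ v)[_ _ surj]] := pcov.
have T : simplex [fset p v; p u; p w]%fset.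
  by apply: flag_triangle => //; apply: covering_neighbor.
have [|s [ss sus] /= ps] := surj [fset p u; p w]%fset.
  split; last by rewrite fsetUA.
  apply: simplexS T; first by apply/fset0Pn; exists (p u); rewrite !inE eqxx.
  by apply/fsubsetP => x; rewrite !inE => /orP[]->; rewrite ?orbT.
have in_s x : neighbor v x -> p x \in [fset p u; p w]%fset -> x \in s.
  rewrite -ps => vx /imfsetP[y /= ys pxy].
  rewrite (@neighbor_lift_unique v x y) //; apply: simplex_neighbor sus _ _.
    by rewrite !inE eqxx.
  by rewrite !inE ys orbT.
by apply: (simplex_neighbor ss); apply: in_s => //; rewrite !inE eqxx ?orbT.
Qed.

Lemma deck_neighbor (g : deck p) (u v : M) :
  neighbor u v -> neighbor (deck_fun g u) (deck_fun g v).
Proof. by case=> [->|/(deck_adjacent g) ?]; [left|right]. Qed.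

Lemma deck_p (g : deck p) (v : M) : p (deck_fun g v) = p v.
Proof. by have [_ _] := deckP g. Qed.

(** Agreement at a vertex propagates along edges by unique lifting, and [M] is
    connected. *)
Lemma deck_free (g h : deck p) (v : M) : deck_fun g v = deck_fun h v -> g = h.
Proof.
move=> ghv; apply: deck_ext => w; elim: (Mconn v w) ghv => //.
- move=> {}v {}w vw ghv; apply: (@neighbor_lift_unique (deck_fun g v)).
  + by apply: deck_neighbor; right.
  + by rewrite ghv; apply: deck_neighbor; right.
  + by rewrite !deck_p.
- by move=> ? ? ? _ IH1 _ IH2 /IH1/IH2.
Qed.

(** The deck transformation that brings [v] onto [u] or next to it; it is unique
    when the images of [u] and [v] are equal or adjacent. It records how the
    edge joining the images lifts, relative to the given points of the fibres. *)
Definition carry (u v : M) : deck p :=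
  xget 1 [set g | neighbor u (deck_fun g v)].

Lemma carryP (u v : M) :
  neighbor (p u) (p v) -> neighbor u (deck_fun (carry u v) v).
Proof.
move=> /neighbor_lift[w uw /esym/preg[g gv]].
apply: (@xgetPex _ 1 [set g | neighbor u (deck_fun g v)]).
by exists g; rewrite /= gv.
Qed.

Lemma carryE (u v : M) (g : deck p) : neighbor u (deck_fun g v) -> carry u v = g.
Proof.
move=> ugv; have /carryP uv : neighbor (p u) (p v).
  by rewrite -(deck_p g v); apply: covering_neighbor.
by apply: (@deck_free _ _ v); apply: neighbor_lift_unique uv ugv _; rewrite !deck_p.
Qed.

Lemma carry_neighbor (u v : M) : neighbor u v -> carry u v = 1.
Proof. by move=> uv; apply: carryE. Qed.

(** A triangle of [L] lifts to [M], so there is no holonomy around it. *)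
Lemma carry_trans (u v w : M) :
  neighbor (p u) (p v) -> neighbor (p v) (p w) -> neighbor (p u) (p w) ->
  carry u v * carry v w = carry u w.
Proof.
move=> /carryP uv /carryP vw uw; apply/esym/carryE; rewrite deck_funM.
apply: neighbor_lift_trans (neighbor_sym uv) (deck_neighbor _ vw) _.
by rewrite !deck_p.
Qed.

Lemma carryV (u v : M) : neighbor (p u) (p v) -> carry u v * carry v u = 1.
Proof.
by move=> uv; rewrite carry_trans ?carry_neighbor //; [left|apply: neighbor_sym|left].
Qed.

Lemma carry_deckl (g : deck p) (u v : M) :
  neighbor (p u) (p v) -> carry (deck_fun g u) v = g * carry u v.
Proof.
by move=> /carryP uv; apply: carryE; rewrite deck_funM; apply: deck_neighbor.
Qed.

Lemma carry_deckr (g : deck p) (u v : M) :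
  neighbor (p u) (p v) -> carry u (deck_fun g v) = carry u v * g^-1.
Proof.
by move=> /carryP uv; apply: carryE; rewrite -deck_funM mulgKV.
Qed.

End Covering.
(** * Normal forms in a right-angled Artin group *)

Section NormalForm.
Variable K : scomplex.

Definition adjb (u v : K) : bool := `[< adjacent u v >].

Lemma adjbC : symmetric adjb.
Proof.
by move=> u v; apply/idP/idP => /asboolP uv; apply/asboolP; apply: adjacent_sym.
Qed.

Lemma adjb_irr : irreflexive adjb.
Proof. by move=> u; apply/asboolP => -[]; rewrite eqxx. Qed.

Definition letter (x : K * bool) : raag K := of_word _ [:: x].

Lemma of_word_cons x w : of_word _ (x :: w) = letter x * of_word (@raag_rel K) w.
Proof. by rewrite -of_wordM. Qed.

Lemma letterK x : letter x * letter (inv_letter x) = 1.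
Proof. by case: x => v b; rewrite -of_wordM; apply/of_wordP/word_eq_cancel. Qed.

Lemma letterV x : letter (inv_letter x) = (letter x)^-1.
Proof. by apply: (@mulgI _ (letter x)); rewrite letterK mulgV. Qed.

Lemma letterC x y :
  commuting adjb x y -> letter x * letter y = letter y * letter x.
Proof.
have gen_comm u v : adjacent u v -> commute (letter (u, true)) (letter (v, true)).
  move=> uv; rewrite /commute -!of_wordM; apply/of_wordP/word_eq_rel.
  by exists u, v.
case: x y => [u b] [v b'] ; rewrite /commuting /= => /asboolP /gen_comm uv.
have letE w e :
    letter (w, e) = if e then letter (w, true) else (letter (w, true))^-1.
  by case: e; rewrite // -letterV.
rewrite (letE u) (letE v); case: b; case: b' => /=; rewrite -/(commute _ _) //.
- exact: commuteV.
- exact/commute_sym/commuteV/commute_sym.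
- exact/commuteV/commute_sym/commuteV/commute_sym.
Qed.

Lemma of_word_shuffle u w :
  shuffle adjb u w -> of_word (@raag_rel K) u = of_word _ w.
Proof.
elim=> {u w} //; first by move=> w u t _ -> _ ->.
- by move=> x y w xy; rewrite !of_word_cons !mulgA letterC.
- by move=> x u w _; rewrite !of_word_cons => ->.
Qed.

Lemma of_word_push x w :
  of_word (@raag_rel K) (push adjb x w) = letter x * of_word _ w.
Proof.
rewrite /push; case: ifP => [/(movable_front adjbC)/of_word_shuffle->|_].
  by rewrite of_word_cons mulgA letterK mul1g.
exact: of_word_cons.
Qed.

(** Reduced words up to [shuffle] form a set on which the group acts. *)
Lemma push_word_eq u u' w :
  word_eq (@raag_rel K) u u' -> reduced adjb w ->
  shuffle adjb (push_word adjb u w) (push_word adjb u' w).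
Proof.
move=> uu'; elim: uu' w => {u u'}.
- by move=> u w _; apply: shuffle_refl.
- by move=> u u' _ IH w /IH/(shuffle_sym adjbC).
- by move=> u v t _ IH1 _ IH2 w rw; apply: shuffle_trans (IH1 w rw) (IH2 w rw).
- move=> u u' v v' _ IHu _ IHv w rw;
  rewrite /push_word !foldr_cat -!/(push_word _ _ _).
  apply: shuffle_trans (push_word_shuffle adjbC adjb_irr u (IHv w rw)) _.
  by apply: IHu; apply: push_word_reduced => //; [apply: adjbC|apply: adjb_irr].
- move=> v b w rw /=; rewrite -{1}[(v, b)]inv_letterK.
  exact: (pushK adjbC adjb_irr (inv_letter (v, b)) rw).
- move=> u v [a [b [/asboolP ab [-> ->]]]] w _ /=.
  exact: (@pushC _ _ adjbC adjb_irr (a, true) (b, true)).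
Qed.

(** A reduced word for [a], obtained by letting [a] act on the empty word.
    It depends on a choice; only its class under [shuffle] is canonical. *)
Definition normal_form (a : raag K) : word K :=
  push_word adjb (to_word a) [::].

Lemma of_word_normal_form a : of_word (@raag_rel K) (normal_form a) = a.
Proof.
rewrite -[RHS]to_wordK /normal_form; elim: (to_word a) => // x u IH.
by rewrite [LHS]of_word_push of_word_cons IH.
Qed.

Lemma normal_form_letter x a :
  shuffle adjb (normal_form (letter x * a)) (push adjb x (normal_form a)).
Proof.
apply: (@push_word_eq _ (x :: to_word a)) => //.
by apply/of_wordP; rewrite to_wordK of_word_cons to_wordK.
Qed.

Lemma shuffle_nil w : shuffle adjb w [::] -> w = [::].
Proof.
by move=> /(all_shuffle pred0); case: w.
Qed.

Lemma normal_form1 : normal_form 1 = [::].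
Proof.
apply/shuffle_nil/(@push_word_eq _ [::]) => //.
by apply/of_wordP; rewrite to_wordK.
Qed.

Lemma normal_form_nil a : (normal_form a == [::]) = (a == 1).
Proof.
apply/eqP/eqP => [na|->]; last exact: normal_form1.
by rewrite -(of_word_normal_form a) na.
Qed.

(** The set of possible last letters of [a] is a clique of [K] by
    [last_in_neighbor], empty only for [a = 1]. It is the direction in which
    [a] is seen from [1]: with [last_in_nested], it retracts the Cayley graph
    without the vertex [1] onto [K]. *)
Definition last_in (a : raag K) : set K :=
  [set v | last_vertex adjb v (normal_form a)].

Lemma last_in_neighbor a u v : last_in a u -> last_in a v -> neighbor u v.
Proof.
move=> au av; case: (last_vertex_clique adjbC au av); first by left.
by move=> /asboolP; right.
Qed.

Lemma last_in_nested x a :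
  last_in a `<=` last_in (letter x * a) \/ last_in (letter x * a) `<=` last_in a.
Proof.
have nx := normal_form_letter x a; rewrite /last_in.
have sh v := last_vertex_shuffle adjbC adjb_irr v nx.
by case: (push_last_vertex adjbC adjb_irr x (normal_form a)) => le; [left|right];
  move=> v /=; rewrite sh; apply: le.
Qed.

Lemma last_in_letter x : last_in (letter x) x.1.
Proof.
rewrite /last_in /= -[letter x]mulg1.
rewrite (last_vertex_shuffle adjbC adjb_irr _ (normal_form_letter x 1)).
by rewrite normal_form1 /= eqxx.
Qed.

Lemma letter_neq1 x : letter x != 1.
Proof.
rewrite -normal_form_nil; apply/eqP => x1.
by have := last_in_letter x; rewrite /last_in /= x1.
Qed.

(** Adjacent vertices are distinct, so the second letter cannot cancel the first. *)
Lemma last_in_letter2 x y : commuting adjb x y ->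
  last_in (letter x) `<=` last_in (letter y * letter x).
Proof.
move=> xy; have yx : commuting adjb y x by rewrite (commutingC adjbC).
have sh1 : shuffle adjb (normal_form (letter x)) [:: x].
  by have := normal_form_letter x 1; rewrite mulg1 normal_form1.
have sh2 : shuffle adjb (normal_form (letter y * letter x)) [:: y; x].
  apply: shuffle_trans (normal_form_letter y _) _.
  apply: shuffle_trans (push_shuffle adjbC adjb_irr _ sh1) _.
  rewrite /push movable_cons_comm //; first exact: shuffle_refl.
  exact: adjb_irr.
move=> v; rewrite /last_in /=.
rewrite (last_vertex_shuffle adjbC adjb_irr v sh1).
rewrite (last_vertex_shuffle adjbC adjb_irr v sh2).
by move=> /= ->.
Qed.

(** The element is nontrivial because it has a possible last letter. *)
Lemma letter2_neq1 x y :
  commuting adjb x y -> letter y * letter x != 1.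
Proof.
move=> xy; apply/eqP => yx1; have := last_in_letter2 xy (last_in_letter x).
by rewrite yx1 /last_in /= normal_form1.
Qed.

End NormalForm.
(** * An action branched over the identity *)

Section BranchedAction.
Variables (L M : scomplex) (p : M -> L).
Hypotheses (Lflag : sc_flag L) (Mconn : sc_connected M).
Hypotheses (pcov : sc_covering p) (preg : sc_regular p).

Let point : Type := (raag L * deck p)%type.

Lemma covering_section : {s : L -> M | cancel s p}.
Proof.
apply: cid; have [_ surj _] := pcov.
have /choice[s sP] : forall l, exists v, p v = l.
  by move=> l; have [v _ vl] := surj l I; exists v.
by exists s.
Qed.

(** The point of [M] that marks the sheet at [a]. Away from [1] it lies over a
    possible last letter of [a], independently of [m]; at [1], which has no
    last letter, the sheet is marked by the vertex [m] along which one arrives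
    or leaves. Thus a letter acts through more than its image in [L] only at
    the branch point. *)
Definition anchor (m : M) (a : raag L) : M :=
  if normal_form a is x :: u then sval covering_section (last x u).1 else m.

Lemma anchor1 m : anchor m 1 = m.
Proof. by rewrite /anchor normal_form1. Qed.

Lemma anchor_neq1 m m' a : a != 1 -> anchor m a = anchor m' a.
Proof. by rewrite -normal_form_nil /anchor; case: (normal_form a). Qed.

Lemma anchor_last_in m a : a != 1 -> last_in a (p (anchor m a)).
Proof.
rewrite -normal_form_nil /anchor /last_in.
case: (normal_form a) => // x u _; rewrite /= (svalP covering_section).
exact: last_vertex_last.
Qed.

Definition proj (x : M * bool) : raag L := letter (p x.1, x.2).

Lemma proj_inv x : proj (inv_letter x) = (proj x)^-1.
Proof. by rewrite -letterV. Qed.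

Lemma proj_last_in x : last_in (proj x) (p x.1).
Proof. exact: last_in_letter. Qed.

(** The anchors at the two ends of an edge of the Cayley graph lie over a common
    simplex, so [carry] is meaningful between them. *)
Lemma anchor_neighbor (x : M * bool) a :
  neighbor (p (anchor x.1 a)) (p (anchor x.1 (proj x * a))).
Proof.
have [->|a1] := eqVneq a 1.
  rewrite mulg1 anchor1; apply: (@last_in_neighbor _ (proj x)).
    exact: proj_last_in.
  exact/anchor_last_in/letter_neq1.
have [xa|xa1] := eqVneq (proj x * a) 1.
  have -> : a = proj (inv_letter x) by rewrite proj_inv (mulg1_eq xa).
  rewrite {2}proj_inv mulgV anchor1; apply/neighbor_sym.
  apply: (@last_in_neighbor _ (proj (inv_letter x))).
    exact: (proj_last_in (inv_letter x)).
  exact/anchor_last_in/letter_neq1.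
have := anchor_last_in x.1 a1; have := anchor_last_in x.1 xa1.
by case: (last_in_nested (p x.1, x.2) a) => le ra rxa;
  [apply: last_in_neighbor (le _ rxa) ra|apply: last_in_neighbor rxa (le _ ra)].
Qed.

(** A point [(a, h)] stands for the sheet [h] over [a]. The letter [x] moves [a]
    along an edge of the Cayley graph of [A_L] and moves the sheet by unique
    lifting along the corresponding path in [L]. *)
Definition step (x : M * bool) (y : point) : point :=
  (proj x * y.1, y.2 * carry p (anchor x.1 y.1) (anchor x.1 (proj x * y.1))).

(** Deck transformations only permute the sheets over the branch point. *)
Definition twist (g : deck p) (y : point) : point :=
  if y.1 == 1 then (y.1, y.2 * g^-1) else y.

Lemma stepK x y : step (inv_letter x) (step x y) = y.
Proof.
case: y => a h; rewrite /step /= proj_inv mulKg; congr pair.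
by rewrite -mulgA carryV ?mulg1 //; apply: anchor_neighbor.
Qed.

Lemma stepKV x y : step x (step (inv_letter x) y) = y.
Proof. by rewrite -{1}(inv_letterK x) stepK. Qed.

Lemma carry_clique (A : set L) (u v w : M) :
  (forall l k, A l -> A k -> neighbor l k) -> A (p u) -> A (p v) -> A (p w) ->
  carry p u v * carry p v w = carry p u w.
Proof. by move=> Acl Au Av Aw; rewrite carry_trans //; apply: Acl. Qed.

(** If the path from [A] to [D] runs through a smaller simplex [B], its ends need
    not lie in one simplex; the point that it passes may still be replaced by any
    common vertex of [A] and [D]. *)
Lemma carry_detour (A B D : set L) (u v w t : M) :
  (forall l k, A l -> A k -> neighbor l k) ->
  (forall l k, B l -> B k -> neighbor l k) ->
  (forall l k, D l -> D k -> neighbor l k) ->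
  A `<=` B \/ B `<=` A -> B `<=` D \/ D `<=` B ->
  A (p u) -> B (p v) -> D (p w) -> A (p t) -> D (p t) ->
  carry p u v * carry p v w = carry p u t * carry p t w.
Proof.
rewrite /subset => Acl Bcl Dcl AB BD Au Bv Dw At Dt.
case: AB => AB; case: BD => BD.
- by rewrite !(carry_clique Dcl) //; auto.
- by rewrite !(carry_clique Bcl) //; auto.
- rewrite -(carry_clique Acl Au At (AB _ Bv)) -mulgA.
  by rewrite (carry_clique Dcl Dt (BD _ Bv) Dw).
- by rewrite !(carry_clique Acl) //; auto.
Qed.

(** At the branch point the two letters are lifted by the vertices [x.1] and
    [y.1] themselves. These being adjacent in [M], the two ways around the square
    start on the same sheet and then stay over one simplex. *)
Lemma step_comm1 x y h : commuting (@adjb M) x y ->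
  step x (step y (1, h)) = step y (step x (1, h)).
Proof.
move=> xy; have yx : commuting (@adjb M) y x by rewrite (commutingC (@adjbC M)).
have proj_comm u v : commuting (@adjb M) u v ->
    commuting (@adjb L) (p u.1, u.2) (p v.1, v.2).
  move=> /asboolP uv; apply/asboolP.
  case: (covering_neighbor pcov (or_intror uv)) => // puv.
  have := neighbor_lift_unique pcov (or_introl (erefl u.1)) (or_intror uv) puv.
  by case: uv => /eqP.
have corner u v : commuting (@adjb M) u v ->
    neighbor (p u.1) (p (anchor v.1 (proj v * proj u))) /\
    (step v (step u (1, h))) =
    (proj v * proj u, h * carry p u.1 (anchor v.1 (proj v * proj u))).
  move=> uv; have uv2 := last_in_letter2 (proj_comm _ _ uv).
  have vu1 : proj v * proj u != 1 := letter2_neq1 (proj_comm _ _ uv).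
  have u_in : last_in (proj v * proj u) (p u.1) by apply/uv2/proj_last_in.
  have vu_in := anchor_last_in v.1 vu1.
  split; first exact: last_in_neighbor u_in vu_in.
  rewrite /step /= !mulg1 anchor1 (anchor_neq1 v.1 u.1 (letter_neq1 _)) -mulgA.
  rewrite (carry_clique (@last_in_neighbor _ _) u_in _ vu_in) //.
  exact/uv2/anchor_last_in/letter_neq1.
have [_ ->] := corner _ _ yx; have [nb ->] := corner _ _ xy.
have comm : proj x * proj y = proj y * proj x by apply/letterC/proj_comm.
rewrite comm; congr (_, _ * _).
have yx1 : proj y * proj x != 1 := letter2_neq1 (proj_comm _ _ xy).
have nb' : neighbor (p y.1) (p (anchor x.1 (proj y * proj x))).
  by have [+ _] := corner _ _ yx; rewrite comm.
have xyn : neighbor y.1 x.1 by right; apply/asboolP.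
rewrite (anchor_neq1 y.1 x.1 yx1) in nb *.
rewrite -(carry_trans Lflag Mconn pcov preg (covering_neighbor pcov xyn) nb nb').
by rewrite carry_neighbor // mul1g.
Qed.

(** The square of the Cayley graph spanned by two commuting letters has no
    holonomy, either because it meets the branch point, or because the simplices
    at its corners are nested along its sides. *)
Lemma step_comm x y z : commuting (@adjb M) x y ->
  step x (step y z) = step y (step x z).
Proof.
move=> xy; have yx : commuting (@adjb M) y x by rewrite (commutingC (@adjbC M)).
case: z => a h.
have [->|a1] := eqVneq a 1; first exact: step_comm1.
(* A corner at the branch point is moved to the start of the square by
   inverting letters. *)
have step1 u v q : commuting (@adjb M) u v -> q.1 = 1 ->
  step u (step v q) = step v (step u q).
  by case: q => _ k uv /= ->; apply: step_comm1.
have [xa1|xa1] := eqVneq (proj x * a) 1.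
  rewrite -{1}(stepK x (a, h)) -(step1 (inv_letter x) y) //.
  by rewrite stepKV.
have [ya1|ya1] := eqVneq (proj y * a) 1.
  rewrite -{2}(stepK y (a, h)) -(step1 (inv_letter y) x) //.
  by rewrite stepKV.
have comm : proj x * (proj y * a) = proj y * (proj x * a).
  rewrite !mulgA; congr (_ * _); have [e _] := step_comm1 1 xy.
  by rewrite !mulg1 in e.
have [xya1|xya1] := eqVneq (proj x * (proj y * a)) 1.
  have := step1 (inv_letter x) (inv_letter y) (step x (step y (a, h))) xy xya1.
  rewrite !stepK => /(congr1 (step x)); rewrite stepKV.
  by move=> /(congr1 (step y)); rewrite stepKV.
rewrite /step /= comm; congr pair; rewrite -!mulgA; congr (_ * _).
rewrite !(anchor_neq1 y.1 x.1) -?comm //.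
have cl := @last_in_neighbor L; have r_in := fun b => @anchor_last_in x.1 b.
have NA := last_in_nested (p y.1, y.2) a; have NA' := last_in_nested (p x.1, x.2) a.
have ND := last_in_nested (p x.1, x.2) (proj y * a).
have ND' := last_in_nested (p y.1, y.2) (proj x * a).
rewrite -!/(proj _) -?comm in NA NA' ND ND'.
move: a1 xa1 ya1 xya1 => /r_in ra /r_in rxa /r_in rya /r_in rd.
(* Both ways around agree once the simplices at opposite corners share a
   vertex. *)
have detour t : last_in a (p t) -> last_in (proj x * (proj y * a)) (p t) ->
    carry p (anchor x.1 a) (anchor x.1 (proj y * a)) *
      carry p (anchor x.1 (proj y * a))
        (anchor x.1 (proj x * (proj y * a))) =
    carry p (anchor x.1 a) (anchor x.1 (proj x * a)) *
      carry p (anchor x.1 (proj x * a))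
        (anchor x.1 (proj x * (proj y * a))).
  move=> at_ dt.
  by rewrite (carry_detour (cl _) (cl _) (cl _) NA ND ra rya rd at_ dt)
    (carry_detour (cl _) (cl _) (cl _) NA' ND' ra rxa rd at_ dt).
case: (NA) (ND) => AB [BD|DB]; [|case: (NA') (ND') => AB' [BD'|DB']| |].
- exact: detour ra (BD _ (AB _ ra)).
- exact: detour ra (BD' _ (AB' _ ra)).
(* Both intermediate simplices contain the anchors of both opposite corners. *)
- rewrite (carry_clique (cl _) (AB _ ra) rya (DB _ rd)).
  by rewrite (carry_clique (cl _) (AB' _ ra) rxa (DB' _ rd)).
- exact: detour (AB' _ rxa) (BD' _ rxa).
- exact: detour (AB' _ (DB' _ rd)) rd.
- exact: detour (AB _ rya) (BD _ rya).
- exact: detour (AB _ (DB _ rd)) rd.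
Qed.

Lemma twistM g h y : twist (g * h) y = twist g (twist h y).
Proof.
case: y => a k; rewrite /twist /=; have [->|/negPf a1] := eqVneq a 1; rewrite /=.
  by rewrite eqxx invgM mulgA.
by rewrite a1.
Qed.

Lemma twist_neq1 g y : y.1 != 1 -> twist g y = y.
Proof. by rewrite /twist => /negPf->. Qed.

Lemma twist_fst g y : (twist g y).1 = y.1.
Proof. by rewrite /twist; case: ifP. Qed.

(** The action of the deck group on the letters is matched by [carry_deckl] and
    [carry_deckr] at edges that meet the branch point; at the other edges only the
    image in [L] of the letter counts. *)
Lemma twist_step g x y :
  twist g (step x y) = step (deck_fun g x.1, x.2) (twist g y).
Proof.
case: y => a h; have nb := anchor_neighbor x a.
have pg : proj (deck_fun g x.1, x.2) = proj x.
  by rewrite /proj /= deck_p.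
rewrite /twist /step /= pg; have [a1|a1] := eqVneq a 1.
  move: nb; rewrite a1 mulg1 (negPf (letter_neq1 _)) /= !anchor1 => nb.
  rewrite (anchor_neq1 (deck_fun g x.1) x.1 (letter_neq1 _)) carry_deckl // mulgA.
  by rewrite -(mulgA h) mulVg mulg1.
rewrite /= (anchor_neq1 (deck_fun g x.1) x.1 a1).
have [xa1|xa1] := eqVneq (proj x * a) 1.
  by move: nb; rewrite xa1 !anchor1 => nb; rewrite carry_deckr // mulgA.
by rewrite (anchor_neq1 (deck_fun g x.1) x.1 xa1).
Qed.

Definition walk (w : word M) (y : point) : point := foldr step y w.

Lemma walk_cat u w y : walk (u ++ w) y = walk u (walk w y).
Proof. exact: foldr_cat. Qed.

Lemma walk_eq u w : word_eq (@raag_rel M) u w -> walk u =1 walk w.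
Proof.
elim=> {u w} //.
- by move=> u w _ IH y.
- by move=> u w t _ IH1 _ IH2 y; rewrite IH1.
- by move=> u u' w w' _ IH1 _ IH2 y; rewrite !walk_cat IH1 IH2.
- by move=> v b y; apply: (stepKV (v, b)).
- move=> u w [a [b [/asboolP ab [-> ->]]]] y.
  exact: (@step_comm (a, true) (b, true)).
Qed.

Lemma walk_height w y :
  height (walk w y).1 = (word_height w + height y.1)%R.
Proof.
elim: w => [|x w IH]; first by rewrite /word_height big_nil add0r.
rewrite /= heightM IH /proj height_of_word /word_height !big_cons big_nil /=.
by rewrite addr0 addrA.
Qed.

Lemma twist_walk g w y :
  twist g (walk w y) = walk (word_act g w) (twist g y).
Proof. by elim: w => //= x w IH; rewrite twist_step IH. Qed.

Definition branched_act (x : Defs.sdprod (raag_act p)) (y : point) : point :=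
  walk (to_word x.1) (twist x.2 y).

Lemma branched_actM x x' y :
  branched_act (x * x') y = branched_act x (branched_act x' y).
Proof.
case: x x' => [a g] [b h]; rewrite /branched_act /= twist_walk -twistM -walk_cat.
apply: walk_eq; by apply/of_wordP; rewrite of_wordM !to_wordK.
Qed.

Lemma branched_act1 y : branched_act 1 y = y.
Proof.
rewrite /branched_act /= (@walk_eq _ [::]); last by apply/of_wordP; rewrite to_wordK.
by rewrite /walk /= /twist invg1 mulg1; case: ifP; case: y.
Qed.

Lemma branched_act_inr g y : branched_act (sdprod_inr (raag_act p) g) y = twist g y.
Proof.
by rewrite /branched_act (@walk_eq _ [::]) //; apply/of_wordP; rewrite to_wordK.
Qed.

Lemma branched_act_height a y :
  height (branched_act (sdprod_inl (raag_act p) a) y).1 = (height a + height y.1)%R.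
Proof. by rewrite /branched_act walk_height twist_fst. Qed.

(** Move the branch point by [b]: the resulting point has height [height b],
    which is not in [S]. A conjugate of the deck group by [c] moves only points
    whose translate by [c]^-1 lies over [1], so points of height [height c]. Hence
    all generators of [N(S)] fix that point, while the conjugate of [g] by [b]
    does not: it changes the sheet over the branch point. *)
Lemma conj_notin_N_subgroup (S : set int) (b : raag M) (g : deck p) :
  ~ S (height b) -> g <> 1 ->
  ~ N_subgroup S (sdprod_inr (raag_act p) g ^ (sdprod_inl (raag_act p) b)^-1).
Proof.
set B := sdprod_inl _ b; set y := branched_act B (1, 1).
have fixN : is_subgroup [set x | branched_act x y = y].
  split=> /= [|x x' xy x'y|x xy]; first exact: branched_act1.
    by rewrite branched_actM x'y.
  by rewrite -{1}xy -branched_actM mulVg branched_act1.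
move=> Sb g1 /(generated_subgroup_min fixN) fixy.
have : branched_act (sdprod_inr (raag_act p) g ^ B^-1) y = y.
  apply: fixy => _ [c [h [Sc ->]]] /=; set C := sdprod_inl _ c.
  have Cy : (branched_act C^-1 y).1 != 1.
    apply/eqP => Cy1; apply: Sb; suff <- : height c = height b by [].
    have : height (branched_act C (branched_act C^-1 y)).1 = height c.
      by rewrite branched_act_height Cy1 height1 addr0.
    rewrite -branched_actM mulgV branched_act1.
    by rewrite branched_act_height height1 addr0.
  by rewrite !branched_actM branched_act_inr twist_neq1 // -branched_actM mulgV
    branched_act1.
rewrite /conjg invgK !branched_actM /y -(branched_actM B^-1) mulVg branched_act1.
rewrite branched_act_inr => /(congr1 (branched_act B^-1)).
rewrite -!branched_actM mulVg !branched_act1 /twist eqxx => /(congr1 snd) gV1.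
by apply: g1; apply: invg_inj; rewrite invg1 -[LHS]mul1g.
Qed.

End BranchedAction.
(** * Group-theoretic preliminaries *)

Section IntegerPowers.
Variable G : groupType.
Implicit Types x y : G.

Definition expz x (n : int) : G :=
  match n with Posz k => x ^+ k | Negz k => x ^- k.+1 end.

Lemma expzDn x (n : int) (k : nat) : expz x (n + Posz k)%R = expz x n * x ^+ k.
Proof.
elim: k n => [|k IH] n; first by rewrite addr0 expg0 mulg1.
rewrite -addn1 PoszD (addrC (Posz k)) addrA IH addn1 expgS mulgA.
congr (_ * _); case: n => [m|[|m]] /=.
- by rewrite addn1 expgSr.
- by rewrite mulVg.
- by rewrite subSS subn0 [x ^+ m.+2]expgS invgM mulgKV.
Qed.

Lemma expzV x n : expz x^-1 n = (expz x n)^-1.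
Proof. by case: n => k /=; rewrite expVgn // invgK. Qed.

Lemma expzM x y n : commute x y -> expz (x * y) n = expz x n * expz y n.
Proof.
move=> xy; case: n => k /=; rewrite expgMn // invgM.
exact/esym/commuteV/commute_sym/commuteV/commuteX2.
Qed.

End IntegerPowers.

Section FiniteIndex.
Variable G : groupType.

(** An element permutes the [k] cosets of [H], so its power [k`!] fixes them all. *)
Lemma finite_index_power (H : set G) :
  is_subgroup H -> finite_index H ->
  exists2 n, (0 < n)%N & forall x y, H ((x ^+ n) ^ y).
Proof.
move=> [H1 HM HV] /finite_seqP[s sE]; pose k := size s.
have HX x n : H x -> H (x ^+ n).
  by move=> Hx; elim: n => // n IH; rewrite expgS; apply: HM.
exists k`!; first exact: fact_gt0.
move=> x y; pose c (i : nat) : set G := [set x ^+ i * y * h | h in H].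
have cs i : c i \in s.
  by have : [set` s] (c i) by rewrite -sE; exists (x ^+ i * y).
(* Pigeonhole: two of the cosets of [y], [x y], ..., [x ^+ k y] coincide. *)
have /(uniqPn (c 0)) : ~~ uniq [seq c i | i <- iota 0 k.+1].
  apply/negP => cuniq.
  suff /(uniq_leq_size cuniq) : {subset [seq c i | i <- iota 0 k.+1] <= s}.
    by rewrite size_map size_iota ltnn.
  by move=> _ /mapP[i _ ->].
rewrite size_map size_iota => -[i [j [ij jk]]].
rewrite !(nth_map 0) ?size_iota ?(ltn_trans ij) // !nth_iota ?(ltn_trans ij) //.
rewrite !add0n => cij.
have Hji : H ((x ^+ (j - i)) ^ y).
  have : c j (x ^+ j * y) by exists 1; rewrite ?mulg1.
  rewrite -cij => -[h Hh e]; suff -> : x ^+ (j - i) ^ y = h by [].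
  rewrite expgnFr 1?ltnW // -expgnFr 1?ltnW //.
  apply: (@mulgI _ (x ^+ i * y)); rewrite e conjgE mulgA mulgK.
  by rewrite !mulgA -expgnDr subnKC // ltnW.
have /dvdnP[q ->] : (j - i %| k`!)%N.
  apply: dvdn_fact; rewrite subn_gt0 ij leq_subLR /=.
  by rewrite (leq_trans (ltnSE jk)) ?leq_addl.
by rewrite mulnC expgnA conjXg; apply: HX.
Qed.

End FiniteIndex.

(** These are stated for a bare function because the maps to which they apply
    are not bundled as morphisms. *)
Section Morphisms.
Variables (G H : groupType) (f : G -> H).
Hypothesis fM : {morph f : x y / x * y}.

Lemma morph_one : f 1 = 1.
Proof. by apply: (@mulgI _ (f 1)); rewrite -fM !mulg1. Qed.

Lemma morph_inv : {morph f : x / x^-1}.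
Proof. by move=> x; apply: (@mulgI _ (f x)); rewrite -fM !mulgV morph_one. Qed.

Lemma morph_exp n : {morph f : x / x ^+ n}.
Proof. by move=> x; elim: n => [|n IH]; rewrite ?morph_one // !expgS fM IH. Qed.

Hypothesis f_eq1 : forall x, f x = 1 -> x = 1.

Lemma virtually_torsion_free_inj :
  virtually_torsion_free H -> virtually_torsion_free G.
Proof.
move=> [K [[K1 KM KV] Kfin Ktf]]; exists [set x | K (f x)]; split.
- split=> /= [|x y Kx Ky|x Kx]; first by rewrite morph_one.
    by rewrite fM; apply: KM.
  by rewrite morph_inv; apply: KV.
- apply: sub_finite_set (finite_image (preimage f) Kfin) => _ [x _ <-].
  exists [set f x * k | k in K]; first by exists (f x).
  apply/seteqP; split=> [y [k Kk e]|_ [k Kk <-]]; last first.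
    by exists (f k) => //; rewrite fM.
  exists (x^-1 * y); last by rewrite mulVKg.
  by rewrite /= fM morph_inv -e mulKg.
- move=> x n Kx n0 xn; apply: f_eq1; apply: Ktf Kx n0 _.
  by rewrite -morph_exp xn morph_one.
Qed.

Lemma residually_finite_inj : residually_finite H -> residually_finite G.
Proof.
move=> rfH x x1; have /rfH[F [g gfx]] : f x <> 1 by move=> /f_eq1.
exists F; pose h := g \o f.
have hM : {morph h : y z / y * z} by move=> y z; rewrite /h /= fM gmulfM.
pose hB := isMultiplicative.Build _ _ h hM.
pose hm : {multiplicative G -> F} := HB.pack h hB.
by exists hm.
Qed.

End Morphisms.

Section Kernel.
Variables (G : groupType) (F : finGroupType) (f : {multiplicative G -> F}).

Lemma kernel_subgroup : is_subgroup [set x | f x = 1].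
Proof.
have fM : {morph f : x y / x * y} by move=> x y; apply: gmulfM.
split=> /= [|x y fx fy|x fx]; first exact: morph_one fM.
  by rewrite gmulfM fx fy mulg1.
by rewrite (morph_inv fM) fx invg1.
Qed.

Lemma kernel_normal x y : [set x | f x = 1] x -> [set x | f x = 1] (x ^ y).
Proof.
have fM : {morph f : x y / x * y} by move=> ? ?; apply: gmulfM.
by move=> /= fx; rewrite conjgE !fM fx mul1g -fM mulVg (morph_one fM).
Qed.

Definition kernel : normal_subgroup G :=
  NormalSubgroup kernel_subgroup kernel_normal.

Lemma kernel_power x : nsub_set kernel (x ^+ #|F|).
Proof.
have fM : {morph f : x y / x * y} by move=> ? ?; apply: gmulfM.
rewrite /= (morph_exp fM) -cardsT.
by apply: (@expg_cardG F (setT_group F)); rewrite inE.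
Qed.

End Kernel.

Section Core.
Variables (G : groupType) (H : set G).
Hypothesis Hsub : is_subgroup H.

Definition core_set : set G := [set x | forall y, H (x ^ y)].

Lemma core_subgroup : is_subgroup core_set.
Proof.
have [H1 HM HV] := Hsub; split=> [y|x x' Hx Hx' y|x Hx y].
- by rewrite conj1g.
- by rewrite conjMg; apply: HM.
- by rewrite conjVg; apply: HV.
Qed.

Lemma core_normal x y : core_set x -> core_set (x ^ y).
Proof. by move=> Hx z; rewrite -conjgM; apply: Hx. Qed.

Definition core : normal_subgroup G := NormalSubgroup core_subgroup core_normal.

Lemma core_sub x : nsub_set core x -> H x.
Proof. by move=> /(_ 1); rewrite conjg1. Qed.

End Core.
(** * The copies of the deck group in the quotient *)

Section SemidirectProduct.
Variables (P A : groupType) (act : group_action P A).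

Lemma sdprod_inlM a b :
  sdprod_inl act (a * b) = sdprod_inl act a * sdprod_inl act b.
Proof. by rewrite sdprod_mulE /= Defs.gact1 mulg1. Qed.

Lemma sdprod_conj_inl b g :
  sdprod_inr act g ^ (sdprod_inl act b)^-1 =
  sdprod_inl act (b * (act g b)^-1) * sdprod_inr act g.
Proof.
rewrite conjgE invgK sdprod_invE !sdprod_mulE /= invg1 !Defs.gact1 !gact_inv.
by rewrite !mulg1 !mul1g.
Qed.

End SemidirectProduct.

Section VertexGroups.
Variables (L M : scomplex) (p : M -> L) (S : set int).

Local Notation iA := (sdprod_inl (raag_act p)).
Local Notation iP := (sdprod_inr (raag_act p)).

Definition conj_deck (b : raag M) (g : deck p) : Defs.sdprod (raag_act p) :=
  iP g ^ (iA b)^-1.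

Lemma in_BB_deckM x y :
  in_BB_deck x -> in_BB_deck y -> in_BB_deck (x * y : Defs.sdprod (raag_act p)).
Proof. exact: (group_closedM (@in_BB_deck_closed _ _ p)). Qed.

Lemma in_BB_inr g : in_BB_deck (iP g).
Proof. by apply/eqP; rewrite /= height1. Qed.

Lemma in_BB_inl a : height a = 0%R -> in_BB_deck (iA a).
Proof. by move=> a0; apply/eqP. Qed.

Lemma in_BB_conj_deck b g : in_BB_deck (conj_deck b g).
Proof.
rewrite /conj_deck sdprod_conj_inl; apply: in_BB_deckM (in_BB_inr g).
apply: in_BB_inl.
by rewrite heightM heightV height_act subrr.
Qed.

Definition BB_elt (x : Defs.sdprod (raag_act p)) (xB : in_BB_deck x) : BB_deck p :=
  exist (fun y => in_BB_deck y) x xB.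

Definition class_of (x : BB_deck p) : GLM p S := to_quotient (N_BB p S) x.

Lemma class_ofM : {morph class_of : x y / x * y}.
Proof. exact: to_quotientM. Qed.

Lemma class_of_eq1 x : class_of x = 1 <-> N_subgroup S (val x).
Proof.
split=> [/esym/(to_quotientP (N_BB p S))|Nx]; first by rewrite invg1 mul1g.
by apply/esym/(to_quotientP (N_BB p S)); rewrite invg1 mul1g.
Qed.

(** Geometrically, the image is the stabilizer of a vertex of height [height b]
    of the branched cover. *)
Definition vertex_map (b : raag M) (g : deck p) : GLM p S :=
  class_of (BB_elt (in_BB_conj_deck b g)).

Lemma vertex_mapM b : {morph vertex_map b : g h / g * h}.
Proof.
move=> g h; rewrite -class_ofM; congr class_of; apply: val_inj.
by rewrite /= /conj_deck sdprod_inrM conjMg.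
Qed.

Lemma vertex_map_eq1 b g : S (height b) -> vertex_map b g = 1.
Proof.
move=> Sb; apply/class_of_eq1; apply: sub_generated_subgroup.
exists b, g; split=> //.
by rewrite /= /conj_deck conjgE invgK mulgA.
Qed.

Definition vertex_pow (u : M) (n : int) : raag M := expz (presented_gen _ u) n.

Lemma height_exp (a : raag M) k : height (a ^+ k) = (height a *+ k)%R.
Proof.
by elim: k => [|k IH]; rewrite ?height1 // expgS heightM IH mulrS.
Qed.

Lemma height_vertex_pow u n : height (vertex_pow u n) = n.
Proof.
by case: n => k; rewrite /vertex_pow /= ?heightV height_exp height_gen natz ?NegzE.
Qed.

Lemma vertex_pow_act g u n :
  raag_act p g (vertex_pow u n) = vertex_pow (deck_fun g u) n.
Proof.
have actX k :
    raag_act p g (presented_gen _ u ^+ k) = presented_gen _ (deck_fun g u) ^+ k.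
  rewrite (@morph_exp _ _ (raag_act p g)); last exact: gact_mul.
  by congr (_ ^+ k); apply: raag_act_of_word.
case: n => k; first exact: actX.
exact: etrans (gact_inv (raag_act p) g _) (congr1 _ (actX _)).
Qed.

Section Periodicity.
Variables (K : normal_subgroup (GLM p S)) (N : nat).
Hypothesis KX : forall x, nsub_set K (x ^+ N).
Hypothesis Mconn : sc_connected M.

Let pow_div (u w : M) n : raag M := vertex_pow u n * (vertex_pow w n)^-1.

Let pow_div_height0 u w n : in_BB_deck (iA (pow_div u w n)).
Proof. by apply: in_BB_inl; rewrite heightM heightV !height_vertex_pow subrr. Qed.

Let quot u w n : GLM p S := class_of (BB_elt (pow_div_height0 u w n)).

Let quot_trans u t w n : quot u t n * quot t w n = quot u w n.
Proof.
rewrite -class_ofM; congr class_of; apply: val_inj.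
by rewrite /= -sdprod_inlM /pow_div mulgA mulgKV.
Qed.

(** For adjacent [u] and [w] the quotient of [n]-th powers is the [n]-th power of
    [u w^-1], so it is periodic modulo [K]; along a path from [u] to [w] these
    quotients multiply. *)
Lemma pow_quotient_periodic u w n :
  nsub_set K ((quot u w n)^-1 * quot u w (n + Posz N)%R).
Proof.
have [K1 KM KV] := nsub_subgroup K.
elim: (Mconn u w) => {u w}.
- move=> u w uw.
  have comm : presented_gen (@raag_rel M) u * presented_gen _ w =
      presented_gen _ w * presented_gen _ u.
    by apply: (@letterC _ (u, true) (w, true)); apply/asboolP.
  pose e := presented_gen (@raag_rel M) u * (presented_gen _ w)^-1.
  have pow_divE m : pow_div u w m = expz e m.
    by rewrite /pow_div /vertex_pow expzM ?expzV //; apply: commuteV.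
  have e0 : in_BB_deck (iA e).
    by apply: in_BB_inl; rewrite heightM heightV !height_gen subrr.
  suff -> : quot u w (n + Posz N)%R = quot u w n * class_of (BB_elt e0) ^+ N.
    by rewrite mulKg.
  rewrite -(morph_exp class_ofM) -class_ofM; congr class_of; apply: val_inj => /=.
  rewrite pow_divE expzDn -pow_divE sdprod_inlM; congr (_ * _).
  rewrite (morph_exp (@sdprod_inlM _ _ (raag_act p))).
  by rewrite (@morph_exp _ _ (fun x : BB_deck p => val x)).
- move=> u; have := quot_trans u u u n; rewrite -[RHS]mulg1 => /mulgI ->.
  have := quot_trans u u u (n + Posz N)%R; rewrite -[RHS]mulg1 => /mulgI ->.
  by rewrite mulVg.
- move=> u t w _ Kut _ Ktw; rewrite -!(quot_trans u t w) invgM.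
  have := KM _ _ (nsub_normal (quot t w n) Kut) Ktw.
  by rewrite conjgE !mulgA mulgK.
Qed.

(** The conjugate of [g] by [u^n] is [u^n] times the inverse of the [n]-th power
    of the translate of [u] by [g], times [g] itself. *)
Lemma vertex_map_periodic u g n :
  nsub_set K (vertex_map (vertex_pow u (n + Posz N)%R) g) <->
  nsub_set K (vertex_map (vertex_pow u n) g).
Proof.
have [K1 KM KV] := nsub_subgroup K.
pose q := class_of (BB_elt (in_BB_inr g)).
have mapE m : vertex_map (vertex_pow u m) g = quot u (deck_fun g u) m * q.
  rewrite -class_ofM; congr class_of; apply: val_inj.
  by rewrite [LHS]sdprod_conj_inl vertex_pow_act.
have := nsub_normal q (pow_quotient_periodic u (deck_fun g u) n).
rewrite !mapE conjgE; set c := quot _ _ n; set c' := quot _ _ _ => Kcc.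
have {}Kcc : nsub_set K ((c * q)^-1 * (c' * q)) by rewrite invgM -!mulgA in Kcc *.
split=> Kc; last by rewrite -(mulVKg (c * q) (c' * q)); apply: KM.
have := KM _ _ Kc (KV _ Kcc).
by rewrite invgM invgK mulgA mulgV mul1g.
Qed.

End Periodicity.
End VertexGroups.
(** * The theorem *)

Lemma profinite_open (U : set int) :
  (forall k, U k -> exists T, [/\ periodic T, T k & T `<=` U]) ->
  open (U : set profinite_int).
Proof.
move=> Uper; rewrite /open /=.
exists [set T : set int | periodic T /\ T `<=` U].
  by move=> T [].
apply/seteqP; split=> [k [T [_ TU] /TU //]|k /Uper[T [pT Tk TU]]].
by exists T.
Qed.

Theorem theorem1p2 (L M : scomplex) (p : M -> L) (S : set int)
  (Lne : sc_nonempty L) (Lfin : sc_finite L) (Lconn : sc_connected L)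
  (Lflag : sc_flag L)
  (Mconn : sc_connected M) (pcov : sc_covering p) (preg : sc_regular p) :
  (virtually_torsion_free (GLM p S) ->
     [\/ S = setT,
         torsion_free (deck p)
       | virtually_torsion_free (deck p) /\ periodic S]) /\
  (residually_finite (GLM p S) ->
     [\/ S = setT,
         [set: deck p] = [set 1]
       | residually_finite (deck p) /\ closed (S : set profinite_int)]).
Proof.
have [v0 _] : exists v : M, True.
  have [l _] := Lne; have [_ surj _] := pcov.
  by have [v _ _] := surj l I; exists v.
pose vm k := @vertex_map _ _ p S (vertex_pow v0 k).
have vmM k : {morph vm k : g h / g * h} := vertex_mapM S _.
have vm_in k g : S k -> vm k g = 1.
  by move=> Sk; apply: vertex_map_eq1; rewrite height_vertex_pow.
have vm_inj k : ~ S k -> forall g, vm k g = 1 -> g = 1.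
  move=> Sk g /class_of_eq1 Ng; apply: contrapT => g1.
  apply: conj_notin_N_subgroup g1 Ng => //.
  by rewrite height_vertex_pow.
have notT : S <> setT -> exists k, ~ S k.
  by move=> ST; apply/existsNP => SA; apply: ST; apply/seteqP; split.
split=> [vtf|rf].
- have [|/notT[s Ss]] := pselect (S = setT); first by constructor 1.
  have [|/existsNP[g /existsNP[n tg]]] := pselect (torsion_free (deck p)).
    by constructor 2.
  constructor 3; split.
    exact: virtually_torsion_free_inj (vmM s) (vm_inj s Ss) vtf.
  have [H [Hsub Hfin Htf]] := vtf.
  have [N N0 HN] := finite_index_power Hsub Hfin.
  (* On the heights in [S] the torsion element [g] dies in the quotient; on the
     others it survives as a torsion element, which avoids [H]. *)
  have SE k : S k <-> nsub_set (core Hsub) (vm k g).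
    split=> [/vm_in->|/core_sub Hg]; first by case: (nsub_subgroup (core Hsub)).
    apply: contrapT => Sk; apply: tg => _ n0 gn; apply: (vm_inj k Sk).
    by apply: Htf Hg n0 _; rewrite -(morph_exp (vmM k)) gn (morph_one (vmM k)).
  exists (Posz N) => //; apply/periodicP => k; rewrite !SE.
  exact: vertex_map_periodic.
- have [|/notT[s Ss]] := pselect (S = setT); first by constructor 1.
  have [D1|D1] := pselect (forall g : deck p, g = 1).
    by constructor 2; apply/seteqP; split=> g _ //; apply: D1.
  have [g g1] := (existsNP _).2 D1.
  constructor 3; split.
    exact: residually_finite_inj (vmM s) (vm_inj s Ss) rf.
  rewrite -openC; apply: profinite_open => k Sk.
  have [F [f fg]] := rf (vm k g) (fun e => g1 (vm_inj k Sk g e)).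
  (* A finite quotient that detects [g] at height [k] detects it on a periodic set
     of heights, and cannot detect it on [S]. *)
  exists [set m | f (vm m g) <> 1]; split=> //.
    exists (Posz #|F|).
      rewrite ltz_nat; apply/card_gt0P; by exists 1.
    apply/periodicP => m; rewrite /= -!/(nsub_set (kernel f) _).
    have := vertex_map_periodic (kernel_power f) Mconn v0 g m.
    by rewrite /= => [[h1 h2]]; split=> + e; apply; [apply: h2|apply: h1].
  by move=> m /= fm Sm; apply: fm; rewrite vm_in //; case: (kernel_subgroup f).
Qed.
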